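(* Let $f=\frac1n\sum_{i=1}^n f_i$, where each $f_i:\mathbb{R}^d\to\mathbb{R}$ is differentiable, bounded below by $f_i^{\inf}\in\mathbb{R}$, and ${\bf L}_i$-matrix smooth with ${\bf L}_i\in\mathbb{S}^d_{++}$. Assume $f\ge f^{\inf}$ on $\mathbb{R}^d$ and $f$ is ${\bf L}$-matrix smooth with ${\bf L}\in\mathbb{S}^d_+$. Let $\{{\bf T}_i^k:i\in[n],k\ge0\}$ be mutually independent random matrices with common distribution $\mathcal T$ on $\mathbb{S}^d_+$ and $\mathbb{E}[{\bf T}_i^k]={\bf I}_d$. Let ${\bf D}\in\mathbb{S}^d_{++}$ satisfy ${\bf D}{\bf L}{\bf D}\preceq{\bf D}$, fix $x^0$, and let $$x^{k+1}=x^k-\frac1n\sum_{i=1}^n{\bf T}_i^k{\bf D}\nabla f_i(x^k).$$ Then for every $K\ge1$, $$\min_{0\le k\le K-1}\mathbb{E}\Big[\|\nabla f(x^k)\|^2_{{\bf D}/\det({\bf D})^{1/d}}\Big]\le\frac{2(1+\frac{\lambda'_{{\bf D}}}{n})^K(f(x^0)-f^{\inf})}{\det({\bf D})^{1/d}K}+\frac{2\lambda'_{{\bf D}}\Delta^{\inf}}{\det({\bf D})^{1/d}n},$$ where $\Delta^{\inf}:=f^{\inf}-\frac1n\sum_if_i^{\inf}$ and $\lambda'_{{\bf D}}:=\max_i\lambda_{\max}\big(\mathbb{E}[{\bf L}_i^{1/2}{\bf D}({\bf T}_i^k-{\bf I}_d){\bf L}({\bf T}_i^k-{\bf I}_d){\bf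 D}{\bf L}_i^{1/2}]\big)$.
   Context: A differentiable $g$ is ${\bf M}$-matrix smooth if $g(x)\le g(y)+\langle\nabla g(y),x-y\rangle+\frac12\langle{\bf M}(x-y),x-y\rangle$ for all $x,y$. $\mathbb{S}^d_{+}$/$\mathbb{S}^d_{++}$: symmetric positive semidefinite/definite matrices; $\preceq$ Loewner order; $\|x\|_{{\bf Q}}^2:=\langle{\bf Q}x,x\rangle$. All expectations assumed finite. *)

(* Defs.v *)
From HB Require Import structures.
From mathcomp Require Import all_boot all_order all_algebra.
From mathcomp Require Import all_classical all_reals all_analysis.
Set Implicit Arguments.
Unset Strict Implicit.
Unset Printing Implicit Defensive.
Import Order.TTheory GRing.Theory Num.Theory.
Import numFieldNormedType.Exports.
Local Open Scope ring_scope.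
Local Open Scope classical_set_scope.

Section defs.
Context {R : realType} {d : nat}.

Definition inner (x y : 'cV[R]_d) : R := \sum_(i < d) x i ord0 * y i ord0.

Definition qnorm2 (Q : 'M[R]_d) (x : 'cV[R]_d) : R := inner (Q *m x) x.

Definition grad (f : 'cV[R]_d -> R) (x : 'cV[R]_d) : 'cV[R]_d :=
  \col_(i < d) ('D_(delta_mx i ord0) f x).

Definition psd (A : 'M[R]_d) : Prop :=
  A^T = A /\ forall x : 'cV[R]_d, 0 <= inner (A *m x) x.
Definition pd (A : 'M[R]_d) : Prop :=
  A^T = A /\ forall x : 'cV[R]_d, x != 0 -> 0 < inner (A *m x) x.

Definition loewner_le (A B : 'M[R]_d) : Prop := psd (B - A).

Definition matrix_smooth (g : 'cV[R]_d -> R) (M : 'M[R]_d) : Prop :=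
  forall x y : 'cV[R]_d,
    g x <= g y + inner (grad g y) (x - y) + 2^-1 * inner (M *m (x - y)) (x - y).

Definition lambda_max (A : 'M[R]_d) : R := sup [set a : R | eigenvalue A a].

(* Borel sigma-algebra on matrices 'M[R]_d ~ R^(d*d): generated by the entries *)
Definition mx_measurable (B : set 'M[R]_d) : Prop :=
  smallest (sigma_algebra setT)
    (\bigcup_(ab in [set: 'I_d * 'I_d])
       preimage_set_system setT (fun A : 'M[R]_d => A ab.1 ab.2) measurable) B.

Definition mutually_independent {dO : measure_display} {Omega : measurableType dO}
  {I : eqType} (P : probability Omega R) (X : I -> Omega -> 'M[R]_d) : Prop :=
  forall (J : seq I) (B : I -> set 'M[R]_d), uniq J ->
    (forall j, j \in J -> mx_measurable (B j)) ->
    P (\bigcap_(j in [set j | j \in J]) (X j @^-1` B j)) =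
    (\prod_(j <- J) P (X j @^-1` B j))%E.

Definition Emx {dO : measure_display} {Omega : measurableType dO}
  (P : probability Omega R) (M : Omega -> 'M[R]_d) : 'M[R]_d :=
  \matrix_(a, b) fine ('E_P[fun w => M w a b])%E.

Definition favg {n : nat} (f : 'I_n -> 'cV[R]_d -> R) (x : 'cV[R]_d) : R :=
  n%:R^-1 * \sum_(i < n) f i x.

Fixpoint iterate {Omega : Type} {n : nat} (f : 'I_n -> 'cV[R]_d -> R)
  (T : nat -> 'I_n -> Omega -> 'M[R]_d) (D : 'M[R]_d) (x0 : 'cV[R]_d)
  (k : nat) (w : Omega) : 'cV[R]_d :=
  match k with
  | 0 => x0
  | k'.+1 =>
      let x := iterate f T D x0 k' w in
      x - n%:R^-1 *: \sum_(i < n) (T k' i w *m D *m grad (f i) x)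
  end.

End defs.

(* Main.v *)
(** Write [W = T - 1], a centred matrix.  Splitting the step into its mean
    [D grad f] and the noise [z = (1/n) sum_i W_i D grad f_i], smoothness of [f]
    and [D L D <= D] give
      f x' <= f x - |grad f|_D^2 / 2 + <z, L D grad f - grad f> + <L z, z> / 2.
    The matrices of a step are independent of the past and of each other, so the
    cross term has mean zero and only the diagonal terms [i = j] of the last
    form survive in the mean.  With [y = L_i^{-1/2} grad f_i] such a term is a
    quadratic form at [y] of the matrix defining [lambda'_D], hence at most
    [lambda'_D |y|^2 <= 2 lambda'_D (f_i - f_i^inf)], the last inequality being
    smoothness of [f_i] tested at [x - L_i^{-1} grad f_i].  Thus
      E gap' <= (1 + lambda'/n) E gap - E |grad f|_D^2 / 2 + lambda' Delta / n,
    which also shows inductively that all these expectations are finite.  The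
    scaling by [det D ^ (1/d)] is harmless for any nonnegative constant. *)

Require Import Defs.
From HB Require Import structures.
From mathcomp Require Import all_boot all_order all_algebra.
From mathcomp Require Import all_classical all_reals all_analysis.
From mathcomp Require Import measurable_realfun ring lra.
Set Implicit Arguments.
Unset Strict Implicit.
Unset Printing Implicit Defensive.
Import Order.TTheory GRing.Theory Num.Theory.
Import numFieldNormedType.Exports.
Local Open Scope ring_scope.
Local Open Scope classical_set_scope.

(** * Real symmetric matrices *)

Section inner_product.
Context {R : realType} {d : nat}.
Implicit Types (x y z : 'cV[R]_d) (A : 'M[R]_d).

Lemma innerE x y : inner x y = (x^T *m y) ord0 ord0.
Proof. by rewrite /inner mxE; apply: eq_bigr => i _; rewrite mxE. Qed.

Lemma innerC x y : inner x y = inner y x.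
Proof. by apply: eq_bigr => i _; rewrite mulrC. Qed.

Lemma innerDl x y z : inner (x + y) z = inner x z + inner y z.
Proof. by rewrite /inner -big_split; apply: eq_bigr => i _; rewrite mxE mulrDl. Qed.

Lemma innerDr x y z : inner z (x + y) = inner z x + inner z y.
Proof. by rewrite innerC innerDl !(innerC z). Qed.

Lemma innerZl a x y : inner (a *: x) y = a * inner x y.
Proof. by rewrite /inner mulr_sumr; apply: eq_bigr => i _; rewrite mxE mulrA. Qed.

Lemma innerZr a x y : inner x (a *: y) = a * inner x y.
Proof. by rewrite innerC innerZl innerC. Qed.

Lemma innerNl x y : inner (- x) y = - inner x y.
Proof. by rewrite -scaleN1r innerZl mulN1r. Qed.

Lemma innerNr x y : inner x (- y) = - inner x y.
Proof. by rewrite innerC innerNl innerC. Qed.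

Lemma inner0l x : inner 0 x = 0.
Proof. by rewrite /inner big1// => i _; rewrite mxE mul0r. Qed.

Lemma inner_suml (I : Type) (s : seq I) (F : I -> 'cV[R]_d) y :
  inner (\sum_(i <- s) F i) y = \sum_(i <- s) inner (F i) y.
Proof.
elim: s => [|i s ih]; first by rewrite !big_nil inner0l.
by rewrite !big_cons innerDl ih.
Qed.

Lemma inner_sumr (I : Type) (s : seq I) (F : I -> 'cV[R]_d) y :
  inner y (\sum_(i <- s) F i) = \sum_(i <- s) inner y (F i).
Proof. by rewrite innerC inner_suml; apply: eq_bigr => i _; rewrite innerC. Qed.

Lemma inner_mulmxl A x y : inner (A *m x) y = inner x (A^T *m y).
Proof. by rewrite !innerE trmx_mul mulmxA. Qed.

Lemma inner_ge0 x : 0 <= inner x x.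
Proof. by apply: sumr_ge0 => i _; rewrite -expr2 sqr_ge0. Qed.

Lemma inner_eq0 x : inner x x = 0 -> x = 0.
Proof.
move=> /eqP; rewrite psumr_eq0 => [/allP h|i _]; last by rewrite -expr2 sqr_ge0.
apply/colP => i; rewrite mxE; apply/eqP.
by have := h i (mem_index_enum _); rewrite /= -expr2 sqrf_eq0.
Qed.

Lemma sqr_coord_le_inner x i : x i ord0 ^+ 2 <= inner x x.
Proof.
rewrite /inner (bigD1 i)//= expr2 lerDl.
by apply: sumr_ge0 => j _; rewrite -expr2 sqr_ge0.
Qed.

Lemma inner_bilinear A x y :
  inner (A *m x) y = \sum_i \sum_j A i j * (x j ord0 * y i ord0).
Proof.
apply: eq_bigr => i _; rewrite mxE mulr_suml.
by apply: eq_bigr => j _; rewrite mulrA.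
Qed.

(** A nonzero kernel vector would make the quadratic form vanish. *)
Lemma pd_unitmx A : pd A -> A \in unitmx.
Proof.
move=> [As Ap]; rewrite unitmxE unitfE -det_tr; apply/det0P => -[v v0 vA].
have w0 : v^T != 0.
  by apply: contraNneq v0 => w; rewrite -(trmxK v) w trmx0.
have := Ap _ w0; rewrite -As -trmx_mul -[X in _ *m X]trmxK trmxK.
by rewrite -[A in v *m A]trmxK As vA trmx0 inner0l ltxx.
Qed.

(* The quadratic form at [x + t w] would go negative for small [t] if
   [w := A x] were nonzero. *)
Lemma psd_form_eq0 A x : psd A -> inner (A *m x) x = 0 -> A *m x = 0.
Proof.
move=> [As Ap] Ax0; apply: inner_eq0.
set w := A *m x; set s := inner w w; set c := inner (A *m w) w.
have s0 : 0 <= s := inner_ge0 w.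
have c0 : 0 <= c := Ap w.
have h t : 0 <= 2 * t * s + t ^+ 2 * c.
  have := Ap (x + t *: w).
  rewrite mulmxDr -scalemxAr !(innerDl, innerDr, innerZl, innerZr) Ax0.
  rewrite (inner_mulmxl A w x) As -/w -/s -/c => /le_trans; apply.
  by rewrite le_eqVlt; apply/orP; left; apply/eqP; ring.
(* Dividing by [c + 1] covers [c = 0]. With [s = t * (c + 1)] the inequality at [- t] reads
   [0 <= - t^2 (c + 2)], hence [t = 0]. *)
have := h (- (s / (c + 1))); set t := s / (c + 1).
have c1 : 0 < c + 1 by lra.
have ts : s = t * (c + 1) by rewrite /t mulfVK// gt_eqF.
have t0 : 0 <= t by rewrite divr_ge0// ltW.
rewrite ts => ht; have : t ^+ 2 <= 0 by nra.
rewrite le_eqVlt ltNge sqr_ge0 orbF sqrf_eq0 => /eqP ->.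
by rewrite mul0r.
Qed.

Lemma continuous_sum_fun (T : topologicalType) (I : Type) (s : seq I)
    (f : I -> T -> R) :
  (forall i, continuous (f i)) -> continuous (fun t => \sum_(i <- s) f i t).
Proof.
move=> cf; elim: s => [|i s ih].
  by under eq_fun do rewrite big_nil; exact: cst_continuous.
under eq_fun do rewrite big_cons.
by move=> t; apply: cvgD; [exact: cf|exact: ih].
Qed.

Lemma continuous_mul_fun (T : topologicalType) (f g : T -> R) :
  continuous f -> continuous g -> continuous (fun t => f t * g t).
Proof. by move=> cf cg t; apply: cvgM; [exact: cf|exact: cg]. Qed.

Lemma continuous_quadratic A :
  continuous (fun v : 'rV[R]_d => inner (A *m v^T) v^T).
Proof.
have -> : (fun v : 'rV[R]_d => inner (A *m v^T) v^T) =
    fun v => \sum_i \sum_j A i j * (v ord0 j * v ord0 i).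
  apply/funext => u; rewrite inner_bilinear; apply: eq_bigr => i _.
  by apply: eq_bigr => j _; rewrite !mxE.
apply: continuous_sum_fun => i; apply: continuous_sum_fun => j.
by apply: continuous_mul_fun;
  [exact: cst_continuous|apply: continuous_mul_fun; exact: coord_continuous].
Qed.

(** Stated for row vectors to fit the extreme value theorem applied to the quadratic form below. *)
Lemma compact_unit_sphere : compact [set v : 'rV[R]_d | inner v^T v^T = 1].
Proof.
apply: bounded_closed_compact.
  exists 1; split => // M M1 v /= v1; apply: le_trans (ltW M1).
  rewrite [leLHS]/Num.Def.normr/= mx_normrE bigmax_le// => -[i j] _ /=.
  have := @sqr_coord_le_inner v^T j; rewrite v1 mxE (ord1 i).
  by rewrite -[X in X <= 1 -> _]real_normK ?num_real// expr_le1.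
have -> : [set v : 'rV[R]_d | inner v^T v^T = 1] =
    (fun v : 'rV[R]_d => inner (1%:M *m v^T) v^T) @^-1` [set 1].
  by apply/seteqP; split => v /=; rewrite mul1mx.
apply: closed_comp; first by move=> v _; exact: continuous_quadratic.
by apply/accessible_closed_set1/hausdorff_accessible/Rhausdorff.
Qed.

(** Let [m] be the maximum of the form on the unit sphere, which is nonempty as [d > 0]. Then
    [m I - A] is positive semidefinite and its form vanishes at a maximiser, which therefore lies in
    its kernel: [m] is an eigenvalue. *)
Lemma rayleigh_le A x : (0 < d)%N -> A^T = A ->
  inner (A *m x) x <= lambda_max A * inner x x.
Proof.
move=> d0 As.
pose S := [set v : 'rV[R]_d | inner v^T v^T = 1].
have S0 : S !=set0.
  exists (delta_mx ord0 (Ordinal d0)); rewrite /S/= trmx_delta /inner.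
  rewrite (bigD1 (Ordinal d0))//= big1 ?mxE ?eqxx ?mul1r ?addr0//.
  by move=> i /negbTE i0; rewrite !mxE i0 mul0r.
have [|v] := EVT_max_rV S0 compact_unit_sphere
   (f := fun v => inner (A *m v^T) v^T).
  by apply: continuous_subspaceT; exact: continuous_quadratic.
rewrite inE => vS vmax.
set m := inner (A *m v^T) v^T in vmax.
have le_m y : inner (A *m y) y <= m * inner y y.
  have [->|y0] := eqVneq y 0; first by rewrite mulmx0 !inner0l mulr0.
  have yy : 0 < inner y y.
    by rewrite lt_neqAle inner_ge0 andbT eq_sym; apply: contra_neq y0; exact: inner_eq0.
  set r := Num.sqrt (inner y y).
  have r2 : r ^+ 2 = inner y y by rewrite sqr_sqrtr// ltW.
  have r0 : r != 0 by rewrite -sqrf_eq0 r2 gt_eqF.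
  have := vmax (r^-1 *: y)^T; rewrite inE /S/= trmxK -scalemxAr.
  rewrite !(innerZl, innerZr) -r2 => /(_ _) h.
  have /h : r^-1 * (r^-1 * r ^+ 2) = 1 by field.
  rewrite mulrA -invfM -expr2 r2 ler_pdivrMl//.
  by rewrite mulrC.
have psdm : psd (m%:M - A).
  split; first by rewrite linearB/= tr_scalar_mx As.
  move=> y; rewrite mulmxBl mul_scalar_mx innerDl innerNl innerZl subr_ge0.
  exact: le_m.
have : (m%:M - A) *m v^T = 0.
  apply: psd_form_eq0 => //; rewrite mulmxBl mul_scalar_mx innerDl innerNl innerZl.
  by rewrite vS mulr1 subrr.
rewrite mulmxBl mul_scalar_mx => /eqP; rewrite subr_eq0 => /eqP /esym Av.
(* [eigenvalue] refers to row vectors acting on the left, so the equation is transposed using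
   symmetry. *)
have eigm : eigenvalue A m.
  apply/eigenvalueP; exists v.
    by rewrite -[v in v *m A]trmxK -As -trmx_mul Av linearZ/= trmxK.
  apply/eqP => v0.
  by have := vS; rewrite /S/= v0 trmx0 inner0l => /esym/eqP; rewrite oner_eq0.
apply: le_trans (le_m x) _; rewrite ler_wpM2r ?inner_ge0//.
(* The supremum dominates [m] only if the spectrum is bounded above; [m] itself is a bound. *)
apply: ub_le_sup => //; exists m => a /= /eigenvalueP[u uA u0].
have ut0 : 0 < inner u^T u^T.
  rewrite lt_neqAle inner_ge0 andbT eq_sym; apply: contra_neq u0 => /inner_eq0 u0.
  by rewrite -(trmxK u) u0 trmx0.
have := le_m u^T; rewrite -[A in A *m _]As -trmx_mul uA linearZ/= innerZl.
by rewrite ler_pM2r.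
Qed.

End inner_product.

(** * Measurability of functions of a random vector *)

Section measurable_continuous.
Context {R : realType} {d : nat} {dT : measure_display} {T : measurableType dT}.

(* Rounded to a grid, [X] takes countably many values, so that [h] of it is
   measurable; refining the grid recovers [h (X t)] by continuity. *)
Let grid (m : nat) (z : {ffun 'I_d -> int}) : 'cV[R]_d :=
  \col_i ((z i)%:~R / m.+1%:R).

Let cell (m : nat) (x : 'cV[R]_d) : {ffun 'I_d -> int} :=
  [ffun i => Num.floor (m.+1%:R * x i ord0)].

Let grid_cell_cvg (x : 'cV[R]_d) : (fun m => grid m (cell m x)) @ \oo --> x.
Proof.
apply/cvgrPdist_le => e e0; near=> m.
have me : m.+1%:R^-1 <= e by apply/ltW; near: m; exact: near_infty_natSinv_lt (PosNum e0).
rewrite [leLHS]/Num.Def.normr/= mx_normrE bigmax_le ?(ltW e0)// => -[i j] _ /=.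
rewrite !mxE ffunE (ord1 j); apply: le_trans me.
have m0 : 0 < m.+1%:R :> R by [].
set y := x i ord0; set fl := Num.floor _.
have -> : y - fl%:~R / m.+1%:R = (m.+1%:R * y - fl%:~R) / m.+1%:R.
  by rewrite mulrBl [m.+1%:R * y]mulrC mulfK// gt_eqF.
rewrite normrM (@ger0_norm _ m.+1%:R^-1) ?invr_ge0// ler_piMl ?invr_ge0//.
have /andP[h1] := floor_itv (m.+1%:R * y); rewrite intrD -/fl => h2.
by rewrite ger0_norm ?subr_ge0//; lra.
Unshelve. all: by end_near. Qed.

Lemma measurable_continuous_comp (h : 'cV[R]_d -> R) (X : T -> 'cV[R]_d) :
  continuous h -> (forall i, measurable_fun setT (fun t => X t i ord0)) ->
  measurable_fun setT (fun t => h (X t)).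
Proof.
move=> ch mX.
apply: (@measurable_fun_cvg _ _ _ _
  (fun m t => h (grid m (cell m (X t))))); last first.
  move=> t _; apply: (@cvg_comp _ _ _ (fun m => grid m (cell m (X t))) h).
    exact: grid_cell_cvg.
  exact: ch.
move=> m _ Y mY; rewrite setTI.
(* The preimage is split according to the grid cell containing [X t]. There are countably many
   cells, and each is cut out by finitely many interval conditions on coordinates. *)
have -> : (fun t => h (grid m (cell m (X t)))) @^-1` Y =
    \bigcup_z [set t | Y (h (grid m z)) /\ cell m (X t) = z].
  apply/seteqP; split => [t /= Yt|t [z _ [/[swap] <-]]//].
  by exists (cell m (X t)).
apply: countable_bigcupT_measurable => [|z]; first exact: countableP.
have [Yz|nYz] := pselect (Y (h (grid m z))); last first.
  by rewrite (_ : mkset _ = set0)//; apply/seteqP; split => // t [].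
rewrite (_ : mkset _ = \bigcap_(i in [set: 'I_d])
   ((fun t => m.+1%:R * X t i ord0) @^-1` `[(z i)%:~R, (z i + 1)%:~R[)); last first.
  apply/seteqP; split => [t [_ /= <-] i _ /=|t /= h1].
    by rewrite ffunE in_itv/=; exact: floor_itv.
  split => //; apply/ffunP => i; rewrite ffunE; apply: floor_def.
  by have := h1 i Logic.I; rewrite /= in_itv.
apply: fin_bigcap_measurable => [|i _]; first exact: finite_finset.
rewrite -[X in measurable X]setTI.
by apply: measurable_funM => //; exact: mX.
Qed.

(** The derivative may be discontinuous, but it is the pointwise limit of the difference quotients
    with steps [1 / (m + 1)], which are continuous in the point. *)
Lemma measurable_derive_comp (h : 'cV[R]_d -> R) (v : 'cV[R]_d) (X : T -> 'cV[R]_d) :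
  (forall x, differentiable h x) ->
  (forall i, measurable_fun setT (fun t => X t i ord0)) ->
  measurable_fun setT (fun t => 'D_v h (X t)).
Proof.
move=> dh mX.
have ch : continuous h by move=> x; exact: differentiable_continuous.
pose s m : R := m.+1%:R^-1.
apply: (@measurable_fun_cvg _ _ _ _
  (fun m t => (s m)^-1 * (h (s m *: v + X t) - h (X t)))) => [m|t _].
  apply: measurable_funM => //; apply: measurable_funB.
    apply: measurable_continuous_comp => // i.
    under eq_fun do rewrite 2!mxE.
    by apply: measurable_funD => //.
  exact: measurable_continuous_comp.
have hD : derivable h (X t) v by exact: diff_derivable.
apply: (@cvg_comp _ _ _ s
  (fun r => r^-1 *: ((h \o shift (X t)) (r *: v) - h (X t))) _ 0^'); last exact: hD.
move=> A /= /nbhs_ballP[e /= e0 eA].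
near=> m; apply: eA => /=.
  rewrite /ball/= sub0r normrN ger0_norm ?invr_ge0//.
  by near: m; exact: near_infty_natSinv_lt (PosNum e0).
by rewrite invr_eq0 pnatr_eq0.
Unshelve. all: by end_near. Qed.

End measurable_continuous.

(** * Expectation and independence *)

Section expectation.
Context {R : realType} {dO : measure_display} {Omega : measurableType dO}.
Variable P : probability Omega R.
Implicit Types X Y : Omega -> R.

(** Integrability is part of the relation because the integral alone is defined for every function;
    finiteness and value of a mean are then proved together. *)
Definition has_mean X (e : R) : Prop :=
  P.-integrable setT (EFin \o X) /\ (\int[P]_w (X w)%:E)%E = e%:E.

Lemma has_mean_measurable X e : has_mean X e -> measurable_fun setT X.
Proof. by move=> [iX _]; apply/measurable_EFinP; exact: measurable_int iX. Qed.

Lemma has_mean_unique X e e' : has_mean X e -> has_mean X e' -> e = e'.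
Proof. by move=> [_ eX] [_]; rewrite eX => -[]. Qed.

Lemma has_meanE X e : has_mean X e -> 'E_P[X]%E = e%:E.
Proof. by move=> [_ <-]; rewrite unlock. Qed.

Lemma integrable_has_mean X :
  P.-integrable setT (EFin \o X) -> exists e, has_mean X e.
Proof.
move=> iX; exists (fine (\int[P]_w (X w)%:E)%E); split => //.
by rewrite fineK//; exact: integrable_fin_num.
Qed.

Lemma has_mean_cst c : has_mean (fun=> c) c.
Proof.
split; first exact: finite_measure_integrable_cst.
by rewrite integral_cst//= (@probability_setT _ _ _ P) mule1.
Qed.

Lemma has_meanD X Y a b : has_mean X a -> has_mean Y b ->
  has_mean (fun w => X w + Y w) (a + b).
Proof.
move=> [iX eX] [iY eY]; split.
  rewrite (_ : _ \o _ = (EFin \o X) \+ (EFin \o Y))%E//.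
  exact: integrableD.
under eq_integral do rewrite EFinD.
by rewrite integralD//= eX eY.
Qed.

Lemma has_meanZ c X a : has_mean X a -> has_mean (fun w => c * X w) (c * a).
Proof.
move=> [iX eX]; split.
  rewrite (_ : _ \o _ = (fun w => c%:E * (EFin \o X) w)%E)//.
  exact: integrableZl.
under eq_integral do rewrite EFinM.
by rewrite integralZl//= eX.
Qed.

Lemma has_mean_sum (I : Type) (s : seq I) (F : I -> Omega -> R) (a : I -> R) :
  (forall i, has_mean (F i) (a i)) ->
  has_mean (fun w => \sum_(i <- s) F i w) (\sum_(i <- s) a i).
Proof.
move=> h; elim: s => [|i s ih].
  by under eq_fun do rewrite big_nil; rewrite big_nil; exact: has_mean_cst.
under eq_fun do rewrite big_cons.
by rewrite big_cons; apply: has_meanD.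
Qed.

Lemma has_mean_le X Y a b : has_mean X a -> has_mean Y b ->
  (forall w, X w <= Y w) -> a <= b.
Proof.
move=> [iX eX] [iY eY] XY; rewrite -lee_fin -eX -eY; apply: le_integral => //.
by move=> w _; rewrite lee_fin.
Qed.

Lemma has_mean_dominated X Y b : measurable_fun setT X -> has_mean Y b ->
  (forall w, `|X w| <= Y w) -> exists a, has_mean X a.
Proof.
move=> mX [iY _] XY; apply: integrable_has_mean.
apply: (@le_integrable _ _ _ _ _ _ _ (EFin \o Y)) => //.
  exact/measurable_EFinP.
by move=> w _ /=; rewrite lee_fin (le_trans (XY w))// ler_norm.
Qed.

(** Measurability of [Y] is a separate premise because [P] may be incomplete. *)
Lemma has_mean_ae X Y a : has_mean X a -> measurable_fun setT Y ->
  {ae P, forall w, X w = Y w} -> has_mean Y a.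
Proof.
move=> [iX eX] mY XY.
have mX := measurable_int _ iX.
have mEY : measurable_fun setT (EFin \o Y) by exact/measurable_EFinP.
have XYae : ae_eq P setT (EFin \o X) (EFin \o Y).
  by apply: filterS XY => w /= ->.
split; last by rewrite -eX; apply/esym/ae_eq_integral.
apply/integrableP; split => //.
rewrite -(@ae_eq_integral _ _ _ _ _ _ (abse \o (EFin \o X)))//.
- by move/integrableP : iX => [].
- exact: measurableT_comp.
- exact: measurableT_comp.
- by apply: filterS XY => w /= ->.
Qed.

(** Both means are integrals of the identity against the common law; integrating the absolute value
    instead transfers integrability. *)
Lemma has_mean_eq_distribution X Y a : has_mean X a -> measurable_fun setT Y ->
  (forall B : set R, measurable B -> P (X @^-1` B) = P (Y @^-1` B)) ->
  has_mean Y a.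
Proof.
move=> hX mY XY; have mX := has_mean_measurable hX.
pose X' : {mfun Omega >-> R} := mfun_Sub (mem_set mX).
pose Y' : {mfun Omega >-> R} := mfun_Sub (mem_set mY).
have eq_int (f : R -> \bar R) :
    (\int[distribution P X']_x f x = \int[distribution P Y']_x f x)%E.
  by apply: eq_measure_integral => B mB _; exact: XY.
have [iX eX] := hX.
have iY : P.-integrable setT (EFin \o Y).
  apply/integrableP; split; first exact/measurable_EFinP.
  have mabs : measurable_fun setT (abse \o EFin : R -> \bar R).
    exact: measurableT_comp.
  have := eq_int (abse \o EFin); rewrite !ge0_integral_distribution//= => <-.
  by have /integrableP[] := iX.
split => //; rewrite -eX; have := eq_int EFin.
by rewrite !integral_distribution.
Qed.

Definition independent_rv X Y := forall A B : set R, measurable A -> measurable B ->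
  (P (X @^-1` A `&` Y @^-1` B) = P (X @^-1` A) * P (Y @^-1` B))%E.

(* The law of [(X, Y)] is the product of the laws, so this is Fubini. *)
Lemma has_meanM X Y a b : independent_rv X Y -> has_mean X a -> has_mean Y b ->
  has_mean (fun w => X w * Y w) (a * b).
Proof.
move=> XY hX hY.
have mX := has_mean_measurable hX; have mY := has_mean_measurable hY.
have mXY : measurable_fun setT (fun w => (X w, Y w)) by exact: measurable_fun_pair.
pose X' : {mfun Omega >-> R} := mfun_Sub (mem_set mX).
pose Y' : {mfun Omega >-> R} := mfun_Sub (mem_set mY).
pose Z' : {mfun Omega >-> (R * R)%type} := mfun_Sub (mem_set mXY).
pose m1 := distribution P X'; pose m2 := distribution P Y'.
have eq_int (f : R * R -> \bar R) :
    (\int[(m1 \x m2)%E]_x f x = \int[distribution P Z']_x f x)%E.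
  apply: eq_measure_integral => B mB _; exact: product_measure_unique.
have [iX eX] := hX; have [iY eY] := hY.
pose mulE (z : R * R) := (z.1 * z.2)%:E.
have mmul : measurable_fun setT mulE.
  by apply/measurable_EFinP; exact: measurable_funM.
have i2 : m2.-integrable setT EFin by exact: integrable_pushforward.
have i1 : m1.-integrable setT EFin by exact: integrable_pushforward.
have e1 : (\int[m1]_x x%:E = a%:E)%E by rewrite integral_distribution.
have e2 : (\int[m2]_x x%:E = b%:E)%E by rewrite integral_distribution.
(* Tonelli: integrating [|x y|] over [y] gives a finite constant times [|x|], which is again
   integrable. *)
have iM : (m1 \x m2)%E.-integrable setT mulE.
  apply/integrable12ltyP => //.
  have [c hc] : exists c, (\int[m2]_y `|y%:E| = c%:E)%E.
    exists (fine (\int[m2]_y `|y%:E|)%E); rewrite fineK//.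
    by apply: integrable_fin_num => //; exact: integrable_abse.
  rewrite (_ : (fun x => _)%E = (fun x => c%:E * `|x%:E|)%E); last first.
    apply/funext => x; rewrite -hc muleC -ge0_integralZl//=.
    - by apply: eq_integral => y _; rewrite normrM EFinM.
    - exact: measurableT_comp.
  rewrite integralZl//; last exact: integrable_abse.
  rewrite ltey_eq fin_numM//; apply: integrable_fin_num => //.
  exact: integrable_abse.
have iXY : P.-integrable setT (EFin \o (fun w => X w * Y w)).
  apply/integrableP; split; first by apply/measurable_EFinP; exact: measurable_funM.
  have /integrableP[_] := iM; rewrite eq_int ge0_integral_distribution//.
  exact: measurableT_comp.
split => //.
have := integral12_prod_meas1 iM; rewrite eq_int integral_distribution// => <-.
rewrite /fubini_F (_ : (fun x => _)%E = (fun x => b%:E * x%:E)%E); last first.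
  apply/funext => x; rewrite /mulE/=; under eq_integral do rewrite EFinM.
  by rewrite integralZl// e2 muleC.
by rewrite integralZl// e1 muleC.
Qed.

End expectation.

(** * Measurable sets and functions of matrices *)

Section mx_measurable.
Context {R : realType} {d : nat}.

(** The sets with measurable preimage form a sigma-algebra containing the generators. *)
Lemma mx_measurable_preimage (dT : measure_display) (T : measurableType dT)
    (X : T -> 'M[R]_d) (B : set 'M[R]_d) :
  (forall a b, measurable_fun setT (fun t => X t a b)) ->
  mx_measurable B -> measurable (X @^-1` B).
Proof.
move=> mX; suff h : @mx_measurable R d `<=` [set B | measurable (X @^-1` B)].
  by move=> mB; exact: h.
apply: smallest_sub => [|_ [[a b] _ [C mC <-]]]; last first.
  by rewrite /= preimage_setI preimage_setT; exact: mX.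
split => [|C mC|F mF].
- by rewrite /= preimage_set0.
- by rewrite /= setTD preimage_setC; exact: measurableC.
- by rewrite /= preimage_bigcup; exact: bigcupT_measurable.
Qed.

Let gens : set (set 'M[R]_d) := \bigcup_(ab in [set: 'I_d * 'I_d])
  preimage_set_system setT (fun A : 'M[R]_d => A ab.1 ab.2) measurable.

(* [mx_measurable] is the sigma-algebra of [g_sigma_algebraType gens], for which
   the closure lemmas on measurable functions are available. *)
Lemma mx_measurableI (A B : set 'M[R]_d) :
  mx_measurable A -> mx_measurable B -> mx_measurable (A `&` B).
Proof.
exact: (@measurableI _ (g_sigma_algebraType gens)).
Qed.

Lemma mx_measurableT : mx_measurable [set: 'M[R]_d].
Proof.
exact: (@measurableT _ (g_sigma_algebraType gens)).
Qed.

Lemma mx_measurable_coord (a b : 'I_d) (B : set R) : measurable B ->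
  mx_measurable ((fun A : 'M[R]_d => A a b) @^-1` B).
Proof.
move=> mB; apply: sub_sigma_algebra; exists (a, b) => //.
by exists B => //; rewrite setTI.
Qed.

Definition mx_measurable_fun (g : 'M[R]_d -> R) : Prop :=
  forall B : set R, measurable B -> mx_measurable (g @^-1` B).

(** This is the shape of the matrix under the expectation in [lambda'_D], seen as a function of the
    random matrix; its measurability lets equality of laws pass to that matrix. *)
Lemma mx_measurable_mulmx (A1 A2 A3 : 'M[R]_d) (a b : 'I_d) :
  mx_measurable_fun
    (fun M => (A1 *m (M - 1%:M) *m A2 *m (M - 1%:M) *m A3) a b).
Proof.
have mc i j : measurable_fun setT (fun M : g_sigma_algebraType gens => (M : 'M[R]_d) i j).
  by move=> _ B mB; rewrite setTI; exact: mx_measurable_coord.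
have mM (A B : g_sigma_algebraType gens -> 'M[R]_d) :
  (forall i j, measurable_fun setT (fun M => A M i j)) ->
  (forall i j, measurable_fun setT (fun M => B M i j)) ->
  forall i j, measurable_fun setT (fun M => (A M *m B M) i j).
  move=> mA mB i j; under eq_fun do rewrite mxE.
  by apply: measurable_sum => k; exact: measurable_funM.
have mK (A : 'M[R]_d) i j : measurable_fun setT (fun M : g_sigma_algebraType gens => A i j).
  exact: measurable_cst.
have m1 i j : measurable_fun setT (fun M : g_sigma_algebraType gens => ((M : 'M[R]_d) - 1%:M) i j).
  under eq_fun do rewrite mxE.
  by apply: measurable_funD => //; exact: mc.
move=> B mB; rewrite -[X in mx_measurable X]setTI.
suff : measurable_fun setT (fun M : g_sigma_algebraType gens =>
  (A1 *m ((M : 'M[R]_d) - 1%:M) *m A2 *m (M - 1%:M) *m A3) a b) by apply.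
by do 4 apply: (mM (fun M => _) (fun M => _)) => //.
Qed.

End mx_measurable.

(** * Independence of functions of disjoint families of matrices *)

Section independence.
Context {R : realType} {dO : measure_display} {Omega : measurableType dO}.
Variable P : probability Omega R.

(** As functions of [A], both sides are finite measures. They agree on a pi-system containing the
    whole space, hence on the sigma-algebra it generates. *)
Lemma independent_generated (G : set (set Omega)) (B : set Omega) :
  setI_closed G -> G `<=` measurable -> G setT -> measurable B ->
  (forall A, G A -> P (A `&` B) = P A * P B)%E ->
  forall A, <<s G >> A -> (P (A `&` B) = P A * P B)%E.
Proof.
move=> GI Gm GT mB GB A GA.
have finB : P B \is a fin_num by exact: fin_num_measure.
have PB0 : 0 <= fine (P B) by exact: fine_ge0.
pose m1 : {measure set Omega -> \bar R} := mrestr P mB.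
pose m2 : {measure set Omega -> \bar R} := mscale (NngNum PB0) P.
have setTE : \bigcup_(_ in [set: nat]) [set: Omega] = setT.
  by apply: bigcup_const; exists 0%N.
have m12 C : G C -> m1 C = m2 C.
  by move=> GC; rewrite /m1 /m2/= /mrestr /mscale/= fineK// muleC GB.
have m1T (k : nat) : (m1 setT < +oo)%E.
  by rewrite /m1/= /mrestr setTI ltey_eq finB.
have := g_sigma_algebra_measure_unique G Gm (fun=> setT) (fun=> GT) setTE m1 m2 GI m12 m1T A GA.
by rewrite /m1 /m2/= /mrestr /mscale/= fineK// muleC.
Qed.

Context {d : nat} {I : eqType} (X : I -> Omega -> 'M[R]_d).
Hypothesis mX : forall j a b, measurable_fun setT (fun w => X j w a b).
Hypothesis indepX : mutually_independent P X.

(* Events depending on finitely many of the [X j] with [Q j]: a pi-system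
   generating the sigma-algebra of these variables. *)
Definition cylinders (Q : pred I) : set (set Omega) :=
  [set E | exists (J : seq I) (B : I -> set 'M[R]_d),
    [/\ uniq J, all Q J, forall j, mx_measurable (B j) &
        E = \bigcap_(j in [set j | j \in J]) (X j @^-1` B j)]].

Lemma cylinders_setI_closed Q : setI_closed (cylinders Q).
Proof.
move=> _ _ [J1 [B1 [u1 q1 m1 ->]]] [J2 [B2 [u2 q2 m2 ->]]].
(* The index lists are merged; an index missing from one list is unconstrained on that side. *)
exists (undup (J1 ++ J2)), (fun j => (if j \in J1 then B1 j else setT) `&`
  (if j \in J2 then B2 j else setT)).
split.
- exact: undup_uniq.
- by apply/allP => j; rewrite mem_undup mem_cat => /orP[]; apply/allP.
- by move=> j; apply: mx_measurableI; case: ifP => _ //; exact: mx_measurableT.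
- apply/seteqP; split => [w [h1 h2] j /= _|w h].
    by split; case: ifP => // jJ; [exact: h1|exact: h2].
  split=> j /= jJ; have := h j; rewrite /= mem_undup mem_cat jJ ?orbT;
    by case=> //.
Qed.

Lemma cylinders_setT Q : cylinders Q setT.
Proof.
exists [::], (fun=> setT); split => //; first by move=> _; exact: mx_measurableT.
by apply/seteqP; split => // w _ j.
Qed.

Lemma cylinders_measurable Q : cylinders Q `<=` measurable.
Proof.
move=> _ [J [B [_ _ mB ->]]]; apply: fin_bigcap_measurable.
  exact: finite_seq.
by move=> j _; exact: mx_measurable_preimage.
Qed.

Lemma sigma_cylinders_measurable Q : <<s cylinders Q >> `<=` measurable.
Proof.
apply: smallest_sub; last exact: cylinders_measurable.
exact: sigma_algebra_measurable.
Qed.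

Lemma cylinders_independent (Q1 Q2 : pred I) (A B : set Omega) :
  (forall j, Q1 j -> ~~ Q2 j) -> cylinders Q1 A -> cylinders Q2 B ->
  (P (A `&` B) = P A * P B)%E.
Proof.
move=> Q12 [J1 [B1 [u1 q1 m1 ->]]] [J2 [B2 [u2 q2 m2 ->]]].
(* The lists are disjoint, so the intersection is a single cylinder over [J1 ++ J2] and its
   probability splits by mutual independence. *)
pose B12 j := if j \in J1 then B1 j else B2 j.
have J12 j : j \in J2 -> j \in J1 = false.
  move=> /(allP q2) Q2j; apply/negP => /(allP q1) /Q12.
  by rewrite Q2j.
rewrite (indepX u1)// (indepX u2)//.
rewrite (_ : _ `&` _ = \bigcap_(j in [set j | j \in J1 ++ J2]) (X j @^-1` B12 j)).
  rewrite indepX; first last.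
  - by move=> j _; rewrite /B12; case: ifP.
  - rewrite cat_uniq u1 u2 andbT/=; apply/hasPn => j jJ2.
    by apply/negP; rewrite /= J12.
  rewrite big_cat/=; congr (_ * _)%E; apply: eq_big_seq => j jJ; rewrite /B12.
    by rewrite jJ.
  by rewrite J12.
apply/seteqP; split => [w [h1 h2] j /=|w h].
  rewrite mem_cat /B12; case: ifPn => [jJ1 _|_ /= jJ2]; [exact: h1|exact: h2].
split => j /= jJ; have := h j; rewrite /= mem_cat jJ ?orbT /B12.
  by rewrite jJ; apply.
by rewrite J12//; apply.
Qed.

(** The product rule is extended from cylinders to the generated sigma-algebras one side at a
    time. *)
Lemma sigma_cylinders_independent (Q1 Q2 : pred I) (A B : set Omega) :
  (forall j, Q1 j -> ~~ Q2 j) ->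
  <<s cylinders Q1 >> A -> <<s cylinders Q2 >> B -> (P (A `&` B) = P A * P B)%E.
Proof.
move=> Q12 sA sB.
apply: (independent_generated (@cylinders_setI_closed Q1)
  (@cylinders_measurable Q1) (@cylinders_setT Q1) (sigma_cylinders_measurable sB)) => // {sA}A cA.
rewrite setIC muleC.
apply: (independent_generated (@cylinders_setI_closed Q2)
  (@cylinders_measurable Q2) (@cylinders_setT Q2)) => //.
  exact: cylinders_measurable cA.
by move=> {sB}B cB; rewrite setIC muleC; exact: (cylinders_independent Q12).
Qed.

(** Measurability for the sigma-algebra generated by the [X j] with [Q j], expressing that [Y]
    depends on these matrices only. *)
Definition determined_by (Q : pred I) (Y : Omega -> R) : Prop :=
  measurable_fun setT (Y : g_sigma_algebraType (cylinders Q) -> R).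

Lemma determined_by_coord (Q : pred I) j a b : Q j ->
  determined_by Q (fun w => X j w a b).
Proof.
move=> Qj _ B mB; rewrite setTI; apply: sub_sigma_algebra.
exists [:: j], (fun=> (fun A : 'M[R]_d => A a b) @^-1` B); split => //=.
- by rewrite Qj.
- by move=> _; exact: mx_measurable_coord.
- apply/seteqP; split => [w Bw k /=|w /(_ j)/=]; last by rewrite mem_head; apply.
  by rewrite inE => /eqP ->.
Qed.

Lemma determined_by_measurable Q Y : determined_by Q Y -> measurable_fun setT Y.
Proof.
move=> mY _ B mB; apply: (@sigma_cylinders_measurable Q).
exact: (mY measurableT B mB).
Qed.

Lemma determined_by_independent (Q1 Q2 : pred I) Y Z :
  (forall j, Q1 j -> ~~ Q2 j) -> determined_by Q1 Y -> determined_by Q2 Z ->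
  independent_rv P Y Z.
Proof.
move=> Q12 mY mZ A B mA mB; apply: (sigma_cylinders_independent Q12).
  by rewrite -[_ @^-1` _]setTI; exact: mY.
by rewrite -[_ @^-1` _]setTI; exact: mZ.
Qed.

End independence.

(** * Square integrable functions and means of bilinear forms *)

Section independent_products.
Context {R : realType} {dO : measure_display} {Omega : measurableType dO}.
Variable P : probability Omega R.
Context {d : nat} {I : eqType} (X : I -> Omega -> 'M[R]_d).
Hypothesis mX : forall j a b, measurable_fun setT (fun w => X j w a b).
Hypothesis indepX : mutually_independent P X.
Implicit Types Q : pred I.

Definition square_integrable Q (Y : Omega -> R) : Prop :=
  determined_by X Q Y /\ exists e, has_mean P (fun w => Y w ^+ 2) e.

Lemma determined_byM Q Y Z : determined_by X Q Y -> determined_by X Q Z ->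
  determined_by X Q (fun w => Y w * Z w).
Proof. exact: measurable_funM. Qed.

Lemma determined_by_sum Q (J : Type) (s : seq J) (F : J -> Omega -> R) :
  (forall j, determined_by X Q (F j)) ->
  determined_by X Q (fun w => \sum_(j <- s) F j w).
Proof. exact: measurable_sum. Qed.

Lemma determined_by_cst Q c : determined_by X Q (fun=> c).
Proof. exact: measurable_cst. Qed.

Lemma square_integrableZ Q c Y :
  square_integrable Q Y -> square_integrable Q (fun w => c * Y w).
Proof.
move=> [dY [e hY]]; split; first by apply: determined_byM => //; exact: determined_by_cst.
by exists (c ^+ 2 * e); under eq_fun do rewrite exprMn; exact: has_meanZ.
Qed.

Lemma square_integrableD Q Y Z : square_integrable Q Y -> square_integrable Q Z ->
  square_integrable Q (fun w => Y w + Z w).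
Proof.
move=> [dY [e hY]] [dZ [e' hZ]].
have dYZ : determined_by X Q (fun w => Y w + Z w) by exact: measurable_funD.
split => //; apply: (has_mean_dominated _ (has_meanD (has_meanZ 2 hY) (has_meanZ 2 hZ))).
  by apply: (determined_by_measurable mX (Q := Q)); exact: measurable_funX.
move=> w; rewrite ger0_norm ?sqr_ge0//.
by have := sqr_ge0 (Y w - Z w); nra.
Qed.

Lemma square_integrable_sum Q (J : Type) (s : seq J) (F : J -> Omega -> R) :
  (forall j, square_integrable Q (F j)) ->
  square_integrable Q (fun w => \sum_(j <- s) F j w).
Proof.
move=> h; elim: s => [|j s ih].
  under eq_fun do rewrite big_nil; split; first exact: determined_by_cst.
  by exists (0 ^+ 2); exact: has_mean_cst.
by under eq_fun do rewrite big_cons; exact: square_integrableD.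
Qed.

Lemma square_integrable_mulmx Q (A : 'M[R]_d) (p : Omega -> 'cV[R]_d) :
  (forall a, square_integrable Q (fun w => p w a ord0)) ->
  forall a, square_integrable Q (fun w => (A *m p w) a ord0).
Proof.
move=> hp a; under eq_fun do rewrite mxE.
by apply: square_integrable_sum => j; exact: square_integrableZ.
Qed.

Lemma square_integrable_has_mean Q Y Z :
  square_integrable Q Y -> square_integrable Q Z ->
  exists e, has_mean P (fun w => Y w * Z w) e.
Proof.
move=> [dY [e hY]] [dZ [e' hZ]].
apply: (has_mean_dominated _ (has_meanD hY hZ)).
  by apply: (determined_by_measurable mX (Q := Q)); exact: determined_byM.
move=> w; rewrite normrM -[Y w ^+ 2]real_normK ?num_real//.
rewrite -[Z w ^+ 2]real_normK ?num_real//.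
have := sqr_ge0 (`|Y w| - `|Z w|); have := normr_ge0 (Y w); have := normr_ge0 (Z w).
by nra.
Qed.

(* Averaging over the independent matrix [M] replaces it by its mean [S]. *)
Lemma has_mean_bilinear Q1 Q2 (M : Omega -> 'M[R]_d) (S : 'M[R]_d)
    (p q : Omega -> 'cV[R]_d) :
  (forall j, Q1 j -> ~~ Q2 j) ->
  (forall a, square_integrable Q1 (fun w => p w a ord0)) ->
  (forall a, square_integrable Q1 (fun w => q w a ord0)) ->
  (forall a b, determined_by X Q2 (fun w => M w a b)) ->
  (forall a b, has_mean P (fun w => M w a b) (S a b)) ->
  exists2 e, has_mean P (fun w => inner (M w *m p w) (q w)) e &
             has_mean P (fun w => inner (S *m p w) (q w)) e.
Proof.
move=> Q12 hp hq dM hM.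
have /choice[e he] (ab : 'I_d * 'I_d) : exists e,
    has_mean P (fun w => p w ab.2 ord0 * q w ab.1 ord0) e.
  exact: (square_integrable_has_mean (hp _) (hq _)).
(* In coordinates, [M a b] is independent of [p b * q a], so the mean of their product is [S a b]
   times that of [p b * q a]. Both forms thus have this mean. *)
exists (\sum_a \sum_b S a b * e (a, b)).
  under eq_fun do rewrite inner_bilinear.
  apply: has_mean_sum => a; apply: has_mean_sum => b.
  rewrite mulrC; under eq_fun do rewrite mulrC.
  apply: has_meanM => //; last exact: (he (a, b)).
  apply: (determined_by_independent mX indepX Q12) => //.
  by apply: determined_byM; [exact: (hp _).1|exact: (hq _).1].
under eq_fun do rewrite inner_bilinear.
apply: has_mean_sum => a; apply: has_mean_sum => b.
by apply: has_meanZ; exact: (he (a, b)).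
Qed.

Lemma has_mean_mulmx (N : Omega -> 'M[R]_d) (H A C : 'M[R]_d) :
  (forall a b, has_mean P (fun w => N w a b) (H a b)) ->
  forall a b, has_mean P (fun w => (A *m N w *m C) a b) ((A *m H *m C) a b).
Proof.
move=> hN a b.
have mulE (M : 'M[R]_d) : (A *m M *m C) a b = \sum_j \sum_i (A a i * C j b) * M i j.
  rewrite mxE; apply: eq_bigr => j _; rewrite mxE mulr_suml.
  by apply: eq_bigr => i _; rewrite mulrAC.
under eq_fun do rewrite mulE.
rewrite mulE; apply: has_mean_sum => j; apply: has_mean_sum => i.
exact: has_meanZ.
Qed.

End independent_products.

(** * Smoothness and descent *)

Section deterministic.
Context {R : realType} {d : nat}.
Implicit Types (x y z : 'cV[R]_d) (L D B M : 'M[R]_d).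

Lemma grad_favg (n : nat) (f : 'I_n -> 'cV[R]_d -> R) x :
  (forall i x, differentiable (f i) x) ->
  grad (favg f) x = n%:R^-1 *: \sum_i grad (f i) x.
Proof.
move=> df; apply/colP => a; rewrite mxE mxE summxE.
have dv i : derivable (f i) x (delta_mx a ord0) by exact: diff_derivable.
have -> : favg f = n%:R^-1 \*: (\sum_i f i).
  by apply/funext => u; rewrite /favg /= fct_sumE.
rewrite deriveZ; last exact: derivable_sum.
by rewrite derive_sum//; congr (_ * _); apply: eq_bigr => i _; rewrite mxE.
Qed.

(* Evaluate the smoothness inequality at [x - M^-1 grad g x]. *)
Lemma matrix_smooth_grad_le (g : 'cV[R]_d -> R) B M (m : R) x y :
  psd B -> B \in unitmx -> B *m B = M -> matrix_smooth g M ->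
  (forall x, m <= g x) ->
  grad g x = B *m y -> inner y y <= 2 * (g x - m).
Proof.
move=> [Bs _] uB BM sm gm gE.
have := le_trans (gm _) (sm (x - invmx B *m y) x).
rewrite [x - _ - x]addrAC subrr add0r -BM mulmxN !(innerNl, innerNr) opprK.
rewrite -mulmxA mulKVmx// gE [inner (B *m y) _]inner_mulmxl Bs mulKVmx//.
lra.
Qed.

(** In the expanded smoothness inequality, [D L D <= D] tested at [g] bounds the part quadratic in
    [g] by [<D g, g> / 2], half of the first-order decrease. *)
Lemma descent_step (F : 'cV[R]_d -> R) L D x z g :
  psd L -> D^T = D -> loewner_le (D *m L *m D) D -> matrix_smooth F L ->
  g = grad F x ->
  F (x - (D *m g + z)) <= F x - 2^-1 * inner (D *m g) g
    + inner z (L *m (D *m g) - g) + 2^-1 * inner (L *m z) z.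
Proof.
move=> [Ls _] Ds [_ DLD] sm gE.
apply: le_trans (sm _ x) _; rewrite -gE [x - _ - x]addrAC subrr add0r.
have := DLD g; rewrite mulmxBl !(innerDl, innerNl) -!mulmxA [inner (D *m (L *m _)) _]inner_mulmxl Ds.
rewrite mulmxN !(innerNl, innerNr) opprK mulmxDr !(innerDl, innerDr, innerNr).
rewrite (inner_mulmxl L z (D *m g)) Ls (innerC (L *m (D *m g)) z) (innerC (D *m g) g) (innerC z g).
move=> h; set p := inner (L *m (D *m g)) (D *m g) in h *; lra.
Qed.

(* If every [r k] exceeded the bound, [e] would lose the same amount at each
   step and become negative after [K] steps. *)
Lemma exists_small_residual (e r : nat -> R) (a c : R) (K : nat) :
  0 <= a -> (0 < K)%N -> (forall k, 0 <= e k) ->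
  (forall k, e k.+1 <= (1 + a) * e k - 2^-1 * r k + a * c) ->
  exists2 k, (k < K)%N & r k <= 2 * (1 + a) ^+ K * e 0%N / K%:R + 2 * a * c.
Proof.
move=> a0 K0 e0 rec; apply: contrapT => hK.
set b := 2 * (1 + a) ^+ K * e 0%N / K%:R in hK.
have K0' : 0 < K%:R :> R by rewrite ltr0n.
have b0 : 0 <= b.
  by rewrite divr_ge0 ?ler0n// !mulr_ge0 ?exprn_ge0 ?e0// addr_ge0.
have rk k : (k < K)%N -> b + 2 * a * c < r k.
  by move=> kK; rewrite ltNge; apply/negP => h; apply: hK; exists k.
(* By [rk] the term [a * c] cancels and each step loses at least [b / 2]. Earlier losses are only
   amplified by the factor [1 + a]. *)
have bound k : (k <= K)%N -> e k <= (1 + a) ^+ k * e 0%N - k%:R * (b / 2).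
  elim: k => [_|k ih kK]; first by rewrite expr0 mul1r mul0r subr0.
  apply: le_trans (rec k) _; have := rk _ kK; have := ih (ltnW kK).
  have k0 : 0 <= k%:R * (b / 2) by apply: mulr_ge0; [exact: ler0n|lra].
  rewrite exprS -[in k.+1%:R]addn1 natrD [(_ + 1) * (b / 2)]mulrDl mul1r.
  set p := (1 + a) ^+ k; set q := k%:R * (b / 2) in k0 *.
  move=> h1 h2.
  have : (1 + a) * e k <= (1 + a) * (p * e 0%N - q) by rewrite ler_wpM2l// addr_ge0.
  by have := mulr_ge0 a0 k0; lra.
(* By the choice of [b], [bound] at [K] only yields [e K <= 0]. The last step is redone with the
   strict inequality [rk] to reach [e K < 0]. *)
have [k Kk] : exists k, K = k.+1 by case: (K) K0 => // k _; exists k.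
have kK : (k < K)%N by rewrite Kk.
have bK : K%:R * (b / 2) = (1 + a) ^+ K * e 0%N.
  by rewrite /b; field; rewrite gt_eqF.
have := rec k; have := rk k kK; have := bound k (ltnW kK); have := e0 k.+1.
have k0 : 0 <= k%:R * (b / 2) by apply: mulr_ge0; [exact: ler0n|lra].
move: bK; rewrite Kk exprS -[in k.+1%:R]addn1 natrD [(_ + 1) * (b / 2)]mulrDl mul1r.
set p := (1 + a) ^+ k; set q := k%:R * (b / 2) in k0 *.
move=> h0 h1 h2 h3 h4.
have : (1 + a) * e k <= (1 + a) * (p * e 0%N - q) by rewrite ler_wpM2l// addr_ge0.
by have := mulr_ge0 a0 k0; lra.
Qed.

End deterministic.

(** * Measurability of the iterates *)

Section measurable_iterate.
Context {R : realType} {d n : nat}.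

(** Stated for an arbitrary measurable structure and for the matrices before step [k] only, so that
    it applies to the sigma-algebra generated by the past. *)
Lemma measurable_iterate (dT : measure_display) (Omega : measurableType dT)
    (f : 'I_n -> 'cV[R]_d -> R) (T : nat -> 'I_n -> Omega -> 'M[R]_d)
    (D : 'M[R]_d) (x0 : 'cV[R]_d) (k : nat) :
  (forall i x, differentiable (f i) x) ->
  (forall l i a b, (l < k)%N -> measurable_fun setT (fun w => T l i w a b)) ->
  forall a, measurable_fun setT (fun w => iterate f T D x0 k w a ord0).
Proof.
move=> df; elim: k => [_ a|k ih mT a]; first exact: measurable_cst.
have mx := ih (fun l i a b lk => mT l i a b (ltnW lk)).
have -> : (fun w => iterate f T D x0 k.+1 w a ord0) = (fun w =>
    iterate f T D x0 k w a ord0 - n%:R^-1 * \sum_i \sum_j \sum_b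
      T k i w a b * D b j * 'D_(delta_mx j ord0) (f i) (iterate f T D x0 k w)).
  apply/funext => w /=; rewrite mxE; congr (_ + _); rewrite !mxE; congr (- (_ * _)).
  rewrite summxE; apply: eq_bigr => i _; rewrite mxE; apply: eq_bigr => j _.
  by rewrite !mxE mulr_suml.
apply: measurable_funB => //; apply: measurable_funM => //.
apply: measurable_sum => i; apply: measurable_sum => j; apply: measurable_sum => b.
apply: measurable_funM; first by apply: measurable_funM => //; exact: mT.
exact: measurable_derive_comp.
Qed.

End measurable_iterate.

(** * The stochastic iteration *)

Section sketched_descent.
Context {R : realType} {d n : nat} {dO : measure_display}.
Context {Omega : measurableType dO} (P : probability Omega R).
Context (f : 'I_n -> 'cV[R]_d -> R) (finf_i : 'I_n -> R) (Li : 'I_n -> 'M[R]_d).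
Context (sqrtLi : 'I_n -> 'M[R]_d) (finf : R) (L : 'M[R]_d).
Context (T : nat -> 'I_n -> Omega -> 'M[R]_d) (D : 'M[R]_d) (x0 : 'cV[R]_d).
Hypothesis d_gt0 : (0 < d)%N.
Hypothesis n_gt0 : (0 < n)%N.
Hypothesis df : forall i x, differentiable (f i) x.
Hypothesis f_ge : forall i x, finf_i i <= f i x.
Hypothesis Li_pd : forall i, pd (Li i).
Hypothesis f_smooth : forall i, matrix_smooth (f i) (Li i).
Hypothesis sqrtLiP : forall i, psd (sqrtLi i) /\ sqrtLi i *m sqrtLi i = Li i.
Hypothesis favg_ge : forall x, finf <= favg f x.
Hypothesis L_psd : psd L.
Hypothesis favg_smooth : matrix_smooth (favg f) L.
Hypothesis mT : forall k i a b, measurable_fun setT (fun w => T k i w a b).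
Hypothesis indepT : mutually_independent P (fun ki : nat * 'I_n => T ki.1 ki.2).
Hypothesis distT : forall k i k' i' (B : set 'M[R]_d), mx_measurable B ->
  P (T k i @^-1` B) = P (T k' i' @^-1` B).
Hypothesis T_psd : forall k i, {ae P, forall w, psd (T k i w)}.
Hypothesis intT : forall k i a b, P.-integrable setT (fun w => (T k i w a b)%:E).
Hypothesis ET : forall k i a b,
  ('E_P[fun w => T k i w a b] = ((1%:M : 'M[R]_d) a b)%:E)%E.
Hypothesis intN : forall k i a b, P.-integrable setT (fun w =>
  ((sqrtLi i *m D *m (T k i w - 1%:M) *m L *m (T k i w - 1%:M) *m D
     *m sqrtLi i) a b)%:E).
Hypothesis D_pd : pd D.
Hypothesis DLD : loewner_le (D *m L *m D) D.

Let X (ki : nat * 'I_n) : Omega -> 'M[R]_d := T ki.1 ki.2.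
Let W k i w : 'M[R]_d := T k i w - 1%:M.
Let N k i w : 'M[R]_d :=
  sqrtLi i *m D *m W k i w *m L *m W k i w *m D *m sqrtLi i.
Let H i : 'M[R]_d := Emx P (N 0%N i).
Let lam : R := \big[Num.max/0]_(i < n) lambda_max (H i).
Let Delta : R := finf - n%:R^-1 * \sum_(i < n) finf_i i.
Let past k : pred (nat * 'I_n) := [pred j | (j.1 < k)%N].
Let present k : pred (nat * 'I_n) := [pred j | j.1 == k].

Let mX j a b : measurable_fun setT (fun w => X j w a b).
Proof. exact: mT. Qed.

Let D_sym : D^T = D := D_pd.1.
Let L_sym : L^T = L := L_psd.1.
Let sqrtLi_sym i : (sqrtLi i)^T = sqrtLi i := (sqrtLiP i).1.1.

Let D_unit : D \in unitmx := pd_unitmx D_pd.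

Let sqrtLi_unit i : sqrtLi i \in unitmx.
Proof.
have := pd_unitmx (Li_pd i); rewrite -(sqrtLiP i).2.
by rewrite unitmx_mul => /andP[].
Qed.

(** * Moments of the centred matrices *)

Let mean_W k i a b : has_mean P (fun w => W k i w a b) 0.
Proof.
have -> : (fun w => W k i w a b) = fun w => T k i w a b + - (1%:M : 'M[R]_d) a b.
  by apply/funext => w; rewrite /W !mxE.
rewrite -(subrr ((1%:M : 'M[R]_d) a b)); apply: has_meanD; last exact: has_mean_cst.
by split; [exact: intT|rewrite -(ET k i); rewrite unlock].
Qed.

Let determined_W k (Q : pred (nat * 'I_n)) i a b : Q (k, i) ->
  determined_by X Q (fun w => W k i w a b).
Proof.
move=> Qki; have -> : (fun w => W k i w a b) =
    fun w => T k i w a b + - (1%:M : 'M[R]_d) a b.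
  by apply/funext => w; rewrite /W !mxE.
apply: measurable_funD; last exact: measurable_cst.
exact: (@determined_by_coord _ _ _ _ _ X Q (k, i)).
Qed.

(** The transpose is kept because [<L z, z>] is expanded at every outcome, while the matrices are
    symmetric only almost surely. *)
Let WLWE k i j w a b : ((W k j w)^T *m L *m W k i w) a b =
  \sum_c \sum_e L e c * (W k j w e a * W k i w c b).
Proof.
rewrite mxE; apply: eq_bigr => c _; rewrite mxE mulr_suml.
by apply: eq_bigr => e _; rewrite mxE; ring.
Qed.

Let determined_WLW k i j a b :
  determined_by X (present k) (fun w => ((W k j w)^T *m L *m W k i w) a b).
Proof.
under eq_fun do rewrite WLWE.
apply: determined_by_sum => c; apply: determined_by_sum => e.
apply: determined_byM; first exact: determined_by_cst.
by apply: determined_byM; apply: determined_W; rewrite /present /= eqxx.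
Qed.

Let mean_WLW_neq k i j a b : i != j ->
  has_mean P (fun w => ((W k j w)^T *m L *m W k i w) a b) 0.
Proof.
move=> ij; under eq_fun do rewrite WLWE.
rewrite [X in has_mean _ _ X](_ : 0 = \sum_(c < d) \sum_(e < d) L e c * (0 * 0)); last first.
  by rewrite big1// => c _; rewrite big1// => e _; rewrite !mulr0.
apply: has_mean_sum => c; apply: has_mean_sum => e; apply: has_meanZ.
apply: has_meanM; [|exact: mean_W|exact: mean_W].
apply: (@determined_by_independent _ _ _ P _ _ X mX indepT (pred1 (k, j)) (pred1 (k, i))).
- by move=> l /eqP ->; rewrite /= xpair_eqE eqxx/= eq_sym.
- by apply: determined_W; rewrite /= eqxx.
- by apply: determined_W; rewrite /= eqxx.
Qed.

(** [H] is computed at step 0; equality of laws carries it to every step. *)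
Let mean_N k i a b : has_mean P (fun w => N k i w a b) (H i a b).
Proof.
have NE l w : N l i w a b =
    (sqrtLi i *m D *m (T l i w - 1%:M) *m L *m (T l i w - 1%:M) *m (D *m sqrtLi i)) a b.
  by rewrite /N /W !mulmxA.
have mN : mx_measurable_fun (fun M : 'M[R]_d =>
    (sqrtLi i *m D *m (M - 1%:M) *m L *m (M - 1%:M) *m (D *m sqrtLi i)) a b).
  exact: mx_measurable_mulmx.
have h0 : has_mean P (fun w => N 0%N i w a b) (H i a b).
  have [e he] := integrable_has_mean (intN 0%N i a b).
  by rewrite /H mxE (has_meanE he).
apply: (has_mean_eq_distribution h0).
  by apply/measurable_EFinP; apply: measurable_int; exact: intN.
move=> B mB; have := distT 0%N i k i (mN _ mB).
by congr (P _ = P _); apply/seteqP; split => w /=; rewrite NE.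
Qed.

Let W_sym k i : {ae P, forall w, (W k i w)^T = W k i w}.
Proof.
apply: filterS (T_psd k i) => w [Ts _].
by rewrite /W linearB/= Ts tr_scalar_mx.
Qed.

Let H_sym i : (H i)^T = H i.
Proof.
apply/matrixP => a b; rewrite mxE.
apply: (has_mean_unique _ (mean_N 0%N i a b)).
apply: (has_mean_ae (mean_N 0%N i b a)).
  exact: has_mean_measurable (mean_N 0%N i a b).
apply: filterS (W_sym 0%N i) => w Ws.
transitivity ((N 0%N i w)^T a b); first by rewrite [RHS]mxE.
by rewrite /N !trmx_mul L_sym D_sym sqrtLi_sym Ws !mulmxA.
Qed.

(** The mean of [W L W], recovered from that of [N] by cancelling the invertible outer factors,
    since integrability is assumed for [N]. *)
Let S i : 'M[R]_d := invmx (sqrtLi i *m D) *m H i *m invmx (D *m sqrtLi i).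

Let mean_WLW k i a b :
  has_mean P (fun w => ((W k i w)^T *m L *m W k i w) a b) (S i a b).
Proof.
have h := has_mean_mulmx (invmx (sqrtLi i *m D)) (invmx (D *m sqrtLi i)) (mean_N k i) a b.
apply: (has_mean_ae h).
  apply: (determined_by_measurable mX (Q := present k)).
  exact: determined_WLW.
apply: filterS (W_sym k i) => w Ws; rewrite Ws /N.
have u1 : sqrtLi i *m D \in unitmx by rewrite unitmx_mul sqrtLi_unit D_unit.
have u2 : D *m sqrtLi i \in unitmx by rewrite unitmx_mul sqrtLi_unit D_unit.
rewrite -[_ *m D *m sqrtLi i]mulmxA -[_ *m D *m W _ _ _ *m L *m _]mulmxA.
rewrite -[_ *m D *m W _ _ _ *m _]mulmxA -[_ *m D *m _ *m (D *m _)]mulmxA.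
by rewrite mulKmx// mulmxK// mulmxA.
Qed.

Let lam_ge0 : 0 <= lam.
Proof. exact: bigmax_ge_id. Qed.

Let S_bound i x : inner (S i *m (D *m grad (f i) x)) (D *m grad (f i) x) <=
  2 * lam * (f i x - finf_i i).
Proof.
set y := invmx (sqrtLi i) *m grad (f i) x.
have gE : grad (f i) x = sqrtLi i *m y by rewrite /y mulKVmx.
have yy := matrix_smooth_grad_le (sqrtLiP i).1 (sqrtLi_unit i) (sqrtLiP i).2
  (f_smooth i) (f_ge i) gE.
(* The vector is [D sqrtLi y], whose matrix cancels against the inverses in [S]. *)
have -> : inner (S i *m (D *m grad (f i) x)) (D *m grad (f i) x) = inner (H i *m y) y.
  rewrite gE [D *m (_ *m y)]mulmxA /S.
  set A1 := sqrtLi i *m D; set A3 := D *m sqrtLi i.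
  have u1 : A1 \in unitmx by rewrite unitmx_mul sqrtLi_unit D_unit.
  have u3 : A3 \in unitmx by rewrite unitmx_mul sqrtLi_unit D_unit.
  have tA3 : A3^T = A1 by rewrite trmx_mul D_sym sqrtLi_sym.
  by rewrite mulmxA mulmxKV// -[_ *m _ *m y]mulmxA innerC inner_mulmxl tA3 mulKVmx// innerC.
apply: le_trans (rayleigh_le _ d_gt0 (H_sym i)) _.
have lamH : lambda_max (H i) <= lam by exact: le_bigmax.
apply: le_trans (ler_wpM2r (inner_ge0 y) lamH) _.
by rewrite [2 * lam]mulrC -mulrA ler_wpM2l.
Qed.

(** * Expectations along the iteration *)

Let x k w := iterate f T D x0 k w.
Let G k w := grad (favg f) (x k w).
Let g k i w := grad (f i) (x k w).
Let gap k w := favg f (x k w) - finf.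
Let z k w := n%:R^-1 *: \sum_i (W k i w *m (D *m g k i w)).

Let n_neq0 : n%:R != 0 :> R.
Proof. by rewrite pnatr_eq0 -lt0n. Qed.

Let gradE k w : G k w = n%:R^-1 *: \sum_i g k i w.
Proof. exact: grad_favg. Qed.

Let iterateE k w : x k.+1 w = x k w - (D *m G k w + z k w).
Proof.
rewrite /x /= -/(x k w); congr (_ - _); rewrite gradE /z -scalemxAr -scalerDr.
congr (_ *: _); rewrite mulmx_sumr -big_split; apply: eq_bigr => i _ /=.
by rewrite /W mulmxBl mul1mx addrC subrK mulmxA.
Qed.

(** [Delta] enters the bound here, by passing from the individual lower bounds to [finf]. *)
Let sum_gap k w : \sum_i (f i (x k w) - finf_i i) = n%:R * (gap k w + Delta).
Proof.
rewrite big_split/= sumrN /gap /Delta /favg.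
by field.
Qed.

Let past_present k j : past k j -> ~~ present k j.
Proof. by rewrite /past /present /= => /ltn_eqF ->. Qed.

Let determined_x k a : determined_by X (past k) (fun w => x k w a ord0).
Proof.
apply: (@measurable_iterate _ _ _ _ (g_sigma_algebraType (cylinders X (past k)))) => //.
by move=> l i b c lk; exact: (@determined_by_coord _ _ _ _ _ X (past k) (l, i)).
Qed.

Let determined_f k i : determined_by X (past k) (fun w => f i (x k w)).
Proof.
apply: (@measurable_continuous_comp _ _ _ (g_sigma_algebraType (cylinders X (past k)))).
  by move=> u; exact: differentiable_continuous.
exact: determined_x.
Qed.

Let determined_g k i a : determined_by X (past k) (fun w => g k i w a ord0).
Proof.
under eq_fun do rewrite mxE.
apply: (@measurable_derive_comp _ _ _ (g_sigma_algebraType (cylinders X (past k)))) => //.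
exact: determined_x.
Qed.

(** The individual gaps are nonnegative, so each is dominated by their sum, which is affine in
    [gap]. *)
Let mean_fi k e i : has_mean P (gap k) e ->
  exists phi, has_mean P (fun w => f i (x k w) - finf_i i) phi.
Proof.
move=> he.
have hD : has_mean P (fun w => n%:R * (gap k w + Delta)) (n%:R * (e + Delta)).
  by apply: has_meanZ; apply: has_meanD => //; exact: has_mean_cst.
apply: (has_mean_dominated _ hD).
  apply: measurable_funB => //.
  by apply: (determined_by_measurable mX (Q := past k)); exact: determined_f.
move=> w; rewrite -sum_gap (bigD1 i)//= ger0_norm ?subr_ge0// lerDl.
by apply: sumr_ge0 => j _; rewrite subr_ge0.
Qed.

Let square_integrable_g k e i : has_mean P (gap k) e ->
  forall a, square_integrable P X (past k) (fun w => g k i w a ord0).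
Proof.
move=> he.
pose y w := invmx (sqrtLi i) *m g k i w.
have gE w : g k i w = sqrtLi i *m y w by rewrite /y mulKVmx.
(* For [y] the smoothness bound applies directly: each squared coordinate is at most
   [2 (f_i - f_i^inf)], which has a finite mean. *)
suff hy a : square_integrable P X (past k) (fun w => y w a ord0).
  move=> a; under eq_fun do rewrite gE.
  exact: (square_integrable_mulmx mX).
have dy : determined_by X (past k) (fun w => y w a ord0).
  under eq_fun do rewrite mxE.
  apply: determined_by_sum => j; apply: determined_byM; first exact: determined_by_cst.
  exact: determined_g.
split=> //; have [phi hphi] := mean_fi i he.
apply: (has_mean_dominated _ (has_meanZ 2 hphi)).
  by apply: (determined_by_measurable mX (Q := past k)); exact: measurable_funX.
move=> w; rewrite ger0_norm ?sqr_ge0//; apply: le_trans (sqr_coord_le_inner _ _) _.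
exact: (matrix_smooth_grad_le (sqrtLiP i).1 (sqrtLi_unit i) (sqrtLiP i).2
  (f_smooth i) (f_ge i) (gE w)).
Qed.

Let square_integrable_G k e : has_mean P (gap k) e ->
  forall a, square_integrable P X (past k) (fun w => G k w a ord0).
Proof.
move=> he a.
have -> : (fun w => G k w a ord0) = fun w => n%:R^-1 * \sum_i g k i w a ord0.
  by apply/funext => w; rewrite gradE mxE summxE.
apply: square_integrableZ; apply: (square_integrable_sum mX) => i.
exact: (square_integrable_g i he).
Qed.

Let mean_cross k e : has_mean P (gap k) e ->
  has_mean P (fun w => inner (z k w) (L *m (D *m G k w) - G k w)) 0.
Proof.
move=> he.
have hq a : square_integrable P X (past k)
    (fun w => (L *m (D *m G k w) - G k w) a ord0).
  have -> : (fun w => (L *m (D *m G k w) - G k w) a ord0) =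
      fun w => ((L *m D - 1%:M) *m G k w) a ord0.
    by apply/funext => w; rewrite mulmxBl mul1mx mulmxA.
  by apply: (square_integrable_mulmx mX); exact: (square_integrable_G he).
have hW i : has_mean P
    (fun w => inner (W k i w *m (D *m g k i w)) (L *m (D *m G k w) - G k w)) 0.
  (* The gradients depend on the past and [W k i] on the present, so the mean equals that of the
     form with the zero matrix. *)
  have [|b c|b c|e' he' h0] := has_mean_bilinear (M := W k i) (S := 0)
    (p := fun w => D *m g k i w) (q := fun w => L *m (D *m G k w) - G k w)
    mX indepT (@past_present k) _ hq.
  - by apply: (square_integrable_mulmx mX); exact: (square_integrable_g i he).
  - by apply: determined_W; rewrite /present /= eqxx.
  - by rewrite mxE; exact: mean_W.
  rewrite (has_mean_unique (has_mean_cst P 0) (e' := e'))//.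
  by have := h0; under eq_fun do rewrite mul0mx inner0l.
rewrite [X in has_mean _ _ X](_ : 0 = n%:R^-1 * \sum_(i < n) 0); last first.
  by rewrite big1// mulr0.
under eq_fun do rewrite innerZl inner_suml.
by apply: has_meanZ; exact: has_mean_sum.
Qed.

Let mean_quadratic k e : has_mean P (gap k) e ->
  exists2 q, has_mean P (fun w => inner (L *m z k w) (z k w)) q &
    q <= 2 * lam / n%:R * (e + Delta).
Proof.
move=> he.
have hu i a : square_integrable P X (past k) (fun w => (D *m g k i w) a ord0).
  by apply: (square_integrable_mulmx mX); exact: (square_integrable_g i he).
(* [c (i, j)] is the mean of the [(i, j)] term of [<L z, z>], without its factor [1 / n^2], and also
   of that term with the random matrix averaged out: [S i] on the diagonal, zero elsewhere. *)
have /choice[c hc] (ij : 'I_n * 'I_n) : exists c,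
    has_mean P (fun w => inner (((W k ij.2 w)^T *m L *m W k ij.1 w)
      *m (D *m g k ij.1 w)) (D *m g k ij.2 w)) c /\
    has_mean P (fun w => inner ((if ij.1 == ij.2 then S ij.1 else 0)
      *m (D *m g k ij.1 w)) (D *m g k ij.2 w)) c.
  case: ij => i j /=.
  have [a b|a b|c h1 h2] := has_mean_bilinear
    (M := fun w => (W k j w)^T *m L *m W k i w) (S := if i == j then S i else 0)
    mX indepT (@past_present k) (hu i) (hu j).
  - exact: determined_WLW.
  - case: eqVneq => [<-|ij]; first exact: mean_WLW.
    by rewrite mxE; exact: mean_WLW_neq.
  by exists c.
have c_neq i j : i != j -> c (i, j) = 0.
  move=> ij; have [_] := hc (i, j); rewrite /= (negbTE ij).
  under eq_fun do rewrite mul0mx inner0l.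
  by move=> h; exact: (has_mean_unique h (has_mean_cst P 0)).
have /choice[phi hphi] i : exists phi, has_mean P (fun w => f i (x k w) - finf_i i) phi.
  exact: (mean_fi i he).
have c_eq i : c (i, i) <= 2 * lam * phi i.
  have [_ h] := hc (i, i); rewrite /= eqxx in h.
  by apply: (has_mean_le h (has_meanZ _ (hphi i))) => w; exact: S_bound.
have phiE : \sum_i phi i = n%:R * (e + Delta).
  have h1 := has_mean_sum (index_enum _) hphi.
  have h2 : has_mean P (fun w => n%:R * (gap k w + Delta)) (n%:R * (e + Delta)).
    by apply: has_meanZ; apply: has_meanD => //; exact: has_mean_cst.
  apply: (has_mean_unique h1); move: h2.
  by under eq_fun do rewrite -sum_gap.
exists (n%:R^-1 * (n%:R^-1 * \sum_i \sum_j c (i, j))).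
  have -> : (fun w => inner (L *m z k w) (z k w)) = fun w => n%:R^-1 * (n%:R^-1 *
      \sum_i \sum_j inner (((W k j w)^T *m L *m W k i w) *m (D *m g k i w))
        (D *m g k j w)).
    apply/funext => w; rewrite /z -scalemxAr innerZl innerZr; congr (_ * (_ * _)).
    rewrite mulmx_sumr inner_suml; apply: eq_bigr => i _.
    rewrite inner_sumr; apply: eq_bigr => j _.
    by rewrite [RHS]innerC -!mulmxA -inner_mulmxl innerC !mulmxA.
  do 2 apply: has_meanZ.
  by apply: has_mean_sum => i; apply: has_mean_sum => j; exact: (hc (i, j)).1.
have -> : \sum_i \sum_j c (i, j) = \sum_i c (i, i).
  apply: eq_bigr => i _; rewrite (bigD1 i)//= big1 ?addr0// => j ji.
  by apply: c_neq; rewrite eq_sym.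
have : \sum_i c (i, i) <= 2 * lam * (n%:R * (e + Delta)).
  by rewrite -phiE mulr_sumr; exact: ler_sum.
(* The sum of the individual gaps carries a factor [n], so [1 / n^2] becomes [1 / n]. *)
move=> h; have n0 : 0 < n%:R :> R by rewrite ltr0n.
rewrite ler_pdivrMl// ler_pdivrMl//; apply: le_trans h _.
by rewrite le_eqVlt; apply/orP; left; apply/eqP; field.
Qed.

Let mean_residual k e : has_mean P (gap k) e ->
  exists r, has_mean P (fun w => qnorm2 D (G k w)) r.
Proof.
move=> he; rewrite /qnorm2.
have h1 : forall i : 'I_d, exists r,
    has_mean P (fun w => (D *m G k w) i ord0 * G k w i ord0) r.
  move=> i; apply: (square_integrable_has_mean mX (Q := past k)).
    by apply: (square_integrable_mulmx mX); exact: (square_integrable_G he).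
  exact: (square_integrable_G he).
have [r hr] := choice h1.
by exists (\sum_i r i); exact: has_mean_sum.
Qed.

(** The next gap is nonnegative and lies below the integrable right side of the descent inequality,
    so its mean is finite; taking means in that inequality gives the recursion. *)
Let mean_step k e r : has_mean P (gap k) e ->
  has_mean P (fun w => qnorm2 D (G k w)) r ->
  exists2 e', has_mean P (gap k.+1) e' &
    e' <= (1 + lam / n%:R) * e - 2^-1 * r + lam / n%:R * Delta.
Proof.
move=> he hr; have [q hq q_le] := mean_quadratic he.
have hU := has_meanD (has_meanD (has_meanD he (has_meanZ (- 2^-1) hr))
  (mean_cross he)) (has_meanZ 2^-1 hq).
have gap_le w : gap k.+1 w <= gap k w + - 2^-1 * qnorm2 D (G k w)
    + inner (z k w) (L *m (D *m G k w) - G k w)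
    + 2^-1 * inner (L *m z k w) (z k w).
  have := descent_step (z k w) L_psd D_sym DLD favg_smooth (erefl (G k w)).
  rewrite -iterateE /gap /qnorm2; lra.
have mgap : measurable_fun setT (gap k.+1).
  apply: measurable_funB => //; apply: measurable_funM => //.
  apply: measurable_sum => i.
  by apply: (determined_by_measurable mX (Q := past k.+1)); exact: determined_f.
have [|e' he'] := has_mean_dominated mgap hU.
  by move=> w; rewrite ger0_norm ?subr_ge0.
exists e' => //; apply: le_trans (has_mean_le he' hU gap_le) _.
have -> : (1 + lam / n%:R) * e - 2^-1 * r + lam / n%:R * Delta =
  e + - 2^-1 * r + 0 + 2^-1 * (2 * lam / n%:R * (e + Delta)) by field.
by rewrite lerD2l ler_wpM2l// invr_ge0.
Qed.

Lemma sketched_descent_rate (K : nat) (c : R) : (1 <= K)%N -> 0 <= c ->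
  (\big[Order.min/+oo]_(k < K)
     'E_P[fun w => qnorm2 (c^-1 *: D) (grad (favg f) (iterate f T D x0 k w))]
   <= ((2 * (1 + lam / n%:R) ^+ K * (favg f x0 - finf)) / (c * K%:R)
       + (2 * lam * Delta) / (c * n%:R))%:E)%E.
Proof.
move=> K1 c0.
have h0 : has_mean P (gap 0%N) (favg f x0 - finf).
  exact: (has_mean_cst P (favg f x0 - finf)).
(* The initial gap is deterministic, and finiteness of the mean propagates from step to step. *)
have /choice[e he] k : exists e, has_mean P (gap k) e.
  elim: k => [|k [e he]]; first by eexists; exact: h0.
  have [r hr] := mean_residual he.
  by have [e' he' _] := mean_step he hr; exists e'.
have /choice[r hr] k : exists r, has_mean P (fun w => qnorm2 D (G k w)) r.
  exact: mean_residual (he k).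
have e_ge0 k : 0 <= e k.
  by apply: (has_mean_le (has_mean_cst P 0) (he k)) => w; rewrite subr_ge0.
have rec k : e k.+1 <= (1 + lam / n%:R) * e k - 2^-1 * r k + lam / n%:R * Delta.
  have [e' he' le_e'] := mean_step (he k) (hr k).
  by rewrite (has_mean_unique (he k.+1) he').
have a0 : 0 <= lam / n%:R by rewrite divr_ge0.
have [k kK rk] := exists_small_residual a0 K1 e_ge0 rec.
rewrite (has_mean_unique (he 0%N) h0) in rk.
have cV0 : 0 <= c^-1 by rewrite invr_ge0.
have hk : has_mean P (fun w => qnorm2 (c^-1 *: D) (G k w)) (c^-1 * r k).
  have -> : (fun w => qnorm2 (c^-1 *: D) (G k w)) =
      fun w => c^-1 * qnorm2 D (G k w).
    by apply/funext => w; rewrite /qnorm2 -scalemxAl innerZl.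
  exact: has_meanZ.
(* The minimum is at most the term at the index [k] just found. *)
apply: (@bigmin_inf _ _ _ _ (Ordinal kK)) => //=.
rewrite (has_meanE hk) lee_fin; apply: le_trans (ler_wpM2l cV0 rk) _.
by rewrite !invfM le_eqVlt; apply/orP; left; apply/eqP; ring.
Qed.

End sketched_descent.

Theorem theorem4 (R : realType) (d n : nat)
  (dO : measure_display) (Omega : measurableType dO) (P : probability Omega R)
  (f : 'I_n -> 'cV[R]_d -> R) (finf_i : 'I_n -> R) (Li : 'I_n -> 'M[R]_d)
  (sqrtLi : 'I_n -> 'M[R]_d)
  (finf : R) (L : 'M[R]_d)
  (T : nat -> 'I_n -> Omega -> 'M[R]_d) (D : 'M[R]_d) (x0 : 'cV[R]_d) :
  (0 < d)%N -> (0 < n)%N ->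
  (* assumptions on the f_i *)
  (forall i x, differentiable (f i) x) ->
  (forall i x, finf_i i <= f i x) ->
  (forall i, pd (Li i)) ->
  (forall i, matrix_smooth (f i) (Li i)) ->
  (* sqrtLi i is the PSD square root L_i^{1/2} *)
  (forall i, psd (sqrtLi i) /\ sqrtLi i *m sqrtLi i = Li i) ->
  (* assumptions on f *)
  (forall x, finf <= favg f x) ->
  psd L -> matrix_smooth (favg f) L ->
  (* random matrices T_i^k: measurable, mutually independent, identically
     distributed, supported in S^d_+, with mean I_d *)
  (forall k i a b, measurable_fun setT (fun w => T k i w a b)) ->
  mutually_independent P (fun ki : nat * 'I_n => T ki.1 ki.2) ->
  (forall k i k' i' (B : set 'M[R]_d), mx_measurable B ->
     P (T k i @^-1` B) = P (T k' i' @^-1` B)) ->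
  (forall k i, {ae P, forall w, psd (T k i w)}) ->
  (forall k i a b, P.-integrable setT (fun w => (T k i w a b)%:E)) ->
  (forall k i a b, ('E_P[fun w => T k i w a b] = ((1%:M : 'M[R]_d) a b)%:E)%E) ->
  (* finiteness of the expectations defining lambda'_D *)
  (forall k i a b, P.-integrable setT (fun w =>
     ((sqrtLi i *m D *m (T k i w - 1%:M) *m L *m (T k i w - 1%:M) *m D
        *m sqrtLi i) a b)%:E)) ->
  (* D *)
  pd D -> loewner_le (D *m L *m D) D ->
  let detD := powR (\det D) (d%:R^-1) in
  let lam := \big[Num.max/0]_(i < n)
     lambda_max (Emx P (fun w => sqrtLi i *m D *m (T 0%N i w - 1%:M) *m L
                                   *m (T 0%N i w - 1%:M) *m D *m sqrtLi i)) in
  let Delta := finf - n%:R^-1 * \sum_(i < n) finf_i i in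
  forall K : nat, (1 <= K)%N ->
  (\big[Order.min/+oo]_(k < K)
     'E_P[fun w => qnorm2 (detD^-1 *: D) (grad (favg f) (iterate f T D x0 k w))]
   <= ((2 * (1 + lam / n%:R) ^+ K * (favg f x0 - finf)) / (detD * K%:R)
       + (2 * lam * Delta) / (detD * n%:R))%:E)%E.

Proof.
move=> d_gt0 n_gt0 df f_ge Li_pd f_smooth sqrtLiP favg_ge L_psd favg_smooth.
move=> mT indepT distT T_psd intT ET intN D_pd DLD detD lam Delta K K1.
exact: (sketched_descent_rate x0 d_gt0 n_gt0 df f_ge Li_pd f_smooth sqrtLiP favg_ge
  L_psd favg_smooth mT indepT distT T_psd intT ET intN D_pd DLD K1 (powR_ge0 _ _)).
Qed.
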